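(* For every $d\in\mathbb{N}$ (with $0\in\mathbb N$), $$\mathrm{P}_d\mathrm{LV}(\mathbb{R}^n)=\bigoplus_{k=0}^{n+d}\mathrm{P}_d\mathrm{LV}_k(\mathbb{R}^n).$$
   Context: $\mathrm{Conv}(\mathbb{R}^n,\mathbb{R})$ is the space of all finite convex functions $f:\mathbb{R}^n\to\mathbb{R}$ with the topology of locally uniform convergence. $\mathcal{M}(\mathbb{R}^n)\cong C_c(\mathbb{R}^n)'$ is the space of complex Radon measures on $\mathbb{R}^n$ with the weak* topology. A map $\Psi:\mathrm{Conv}(\mathbb{R}^n,\mathbb{R})\to\mathcal{M}(\mathbb{R}^n)$ is a local functional if $f|_U=h|_U$ for some open $U\subset\mathbb{R}^n$ implies $\Psi(f)|_U=\Psi(h)|_U$. Let $\mathrm{A}(n,\mathbb{R})$ be the space of all affine functions $\ell:\mathbb{R}^n\to\mathbb{R}$. A local functional $\Psi$ is polynomial of degree at most $d$ if for every $f\in\mathrm{Conv}(\mathbb{R}^n,\mathbb{R})$ the map $\mathrm{A}(n,\mathbb{R})\to\mathcal{M}(\mathbb{R}^n)$, $\ell\mapsto\Psi(f+\ell)$, is a polynomial of degree at most $d$. $\mathrm{P}_d\mathrm{LV}(\mathbb{R}^n)$ is the complex vector space of all continuous local functionals on $\mathrm{Conv}(\mathbb{R}^n,\mathbb{R})$ that are polynomial of degree at most $d$, and $\mathrm{P}_d\mathrm{LV}_k(\mathbb{R}^n)$ is the subspace of all $k$-homogeneous ones, i.e. those with $\Psi(tf)=t^k\Psi(f)$ for all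 $f\in\mathrm{Conv}(\mathbb{R}^n,\mathbb{R})$, $t\ge 0$. *)

(* Defs.v *)
(* R^n is 'rV[R]_n and the field of complex numbers is R[i]. *)
From HB Require Import structures.
From mathcomp Require Import all_boot all_order all_algebra.
From mathcomp Require Import all_classical all_reals all_analysis.
From mathcomp Require Import complex ring.

Set Implicit Arguments.
Unset Strict Implicit.
Unset Printing Implicit Defensive.

Import Order.TTheory GRing.Theory Num.Theory.
Import numFieldNormedType.Exports.

Local Open Scope classical_set_scope.
Local Open Scope ring_scope.
Local Open Scope complex_scope.

Section FiniteConvexFunctions.
Context (R : realType) (n : nat).

Definition convex_pred : {pred 'rV[R]_n -> R} :=
  fun f => `[< @convex_function R 'rV[R]_n setT f >].

Record Conv := MkConv {
  conv_fun :> 'rV[R]_n -> R;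
  conv_funP : conv_fun \in convex_pred }.

HB.instance Definition _ := [isSub for conv_fun].
HB.instance Definition _ := [Choice of Conv by <:].

(* Compact convergence, which on the locally compact space R^n is the same as
   locally uniform convergence. *)
HB.instance Definition _ := Topological.copy Conv
  (initial_topology (conv_fun : Conv -> {family compact, 'rV[R]_n -> R})).

(* v = (a, c) in R^n x R parametrizes the affine function x |-> <a, x> + c;
   this is a linear bijection from R^(n + 1) onto A(n, R). *)
Definition affine_fun (v : 'rV[R]_(n + 1)) (x : 'rV[R]_n) : R :=
  \sum_(i < n) lsubmx v 0 i * x 0 i + rsubmx v 0 0.

Lemma conv_affine_subproof (f : Conv) v :
  (fun x => f x + affine_fun v x) \in convex_pred.
Proof.
case: f => f /= /asboolP cf; apply/asboolP => t x y xT yT.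
have := cf t x y xT yT; rewrite /conv /= /conv /= => le.
have -> : affine_fun v (t%:num *: x + (1 - t%:num) *: y) =
    t%:num * affine_fun v x + (1 - t%:num) * affine_fun v y.
  rewrite /affine_fun !mulrDr addrACA -mulrDl addrCA subrr addr0 mul1r.
  congr (_ + _); rewrite !mulr_sumr -big_split /=.
  by apply: eq_bigr => i _; rewrite !mxE; ring.
rewrite [X in _ <= X](_ : _ = t%:num * f x + (1 - t%:num) * f y +
  (t%:num * affine_fun v x + (1 - t%:num) * affine_fun v y)) ?lerD2r //.
by rewrite /GRing.scale /= /unstable.onem; ring.
Qed.

Definition conv_affine (f : Conv) v : Conv := MkConv (conv_affine_subproof f v).

Lemma conv_scale_subproof (t : {nonneg R}) (f : Conv) :
  (fun x => t%:num * f x) \in convex_pred.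
Proof.
case: f => f /= /asboolP cf; apply/asboolP => s x y xT yT.
have /(ler_wpM2l (ge0 t)) := cf s x y xT yT; rewrite /conv /= /conv /=.
move/le_trans; apply; rewrite le_eqVlt; apply/orP; left; apply/eqP.
by rewrite /GRing.scale /=; ring.
Qed.

Definition conv_scale (t : {nonneg R}) (f : Conv) : Conv :=
  MkConv (conv_scale_subproof t f).

End FiniteConvexFunctions.

Section RadonMeasures.
Context (R : realType) (n : nat).

Lemma continuous_lincomb (T : topologicalType) (a : R[i]) (f g : T -> R[i]^o) :
  continuous f -> continuous g -> continuous (fun x => a *: f x + g x).
Proof.
move=> cf cg x; apply: cvgD; last exact: cg.
by apply: cvgZl_tmp; exact: cf.
Qed.

Definition tsupport (phi : 'rV[R]_n -> R[i]) : set 'rV[R]_n :=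
  closure [set x | phi x != 0].

Definition Cc_pred : {pred 'rV[R]_n -> R[i]} :=
  fun phi => `[< continuous (phi : 'rV[R]_n -> R[i]^o) /\
                 compact (tsupport phi) >].

Lemma tsupport_linear (a : R[i]) (phi psi : 'rV[R]_n -> R[i]) :
  tsupport (a *: phi + psi) `<=` tsupport phi `|` tsupport psi.
Proof.
rewrite /tsupport -closureU; apply: closure_subset => x /=.
apply: contraNP => /not_orP[/negP + /negP]; rewrite !negbK => /eqP p0 /eqP q0.
by change (a * phi x + psi x == 0); rewrite p0 q0 mulr0 addr0.
Qed.

Lemma Cc_submod_closed : submod_closed Cc_pred.
Proof.
split.
  apply/asboolP; split; first exact: (@cst_continuous _ R[i]^o 0).
  have -> : tsupport 0 = set0; last exact: compact0.
  rewrite /tsupport -[RHS]closure0; congr closure.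
  by apply/seteqP; split => // x /=; rewrite eqxx.
move=> a phi psi /asboolP[cphi kphi] /asboolP[cpsi kpsi].
apply/asboolP; split.
  exact: continuous_lincomb cphi cpsi.
apply: (subclosed_compact _ (compactU kphi kpsi)); first exact: closed_closure.
exact: tsupport_linear.
Qed.

HB.instance Definition _ :=
  GRing.isSubmodClosed.Build R[i] ('rV[R]_n -> R[i]) Cc_pred Cc_submod_closed.

Record Cc := MkCc {
  Cc_fun :> 'rV[R]_n -> R[i];
  Cc_funP : Cc_fun \in Cc_pred }.

HB.instance Definition _ := [isSub for Cc_fun].
HB.instance Definition _ := [Choice of Cc by <:].
HB.instance Definition _ := [SubChoice_isSubLmodule of Cc by <:].

(* A complex Radon measure is identified with its integral, a linear form on
   C_c(R^n) that is continuous for the inductive limit topology: it is bounded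
   for the sup norm on the functions supported in any given compact set K. *)
Definition radon_pred : {pred Cc -> R[i]} :=
  fun mu => `[< scalar mu /\
    forall K : set 'rV[R]_n, compact K -> exists C : R,
      forall (phi : Cc) (M : R), tsupport phi `<=` K ->
        (forall x, `|phi x| <= M%:C) -> `|mu phi| <= (C * M)%:C >].

Lemma radon_submod_closed : submod_closed radon_pred.
Proof.
split.
  apply/asboolP; split; first by move=> a phi psi; rewrite /= mulr0 addr0.
  by move=> K _; exists 0 => phi M _ _; rewrite /= mul0r normr0.
move=> a mu nu /asboolP[smu bmu] /asboolP[snu bnu].
apply/asboolP; split.
  move=> b phi psi; change (a * mu (b *: phi + psi) + nu (b *: phi + psi) =
    b * (a * mu phi + nu phi) + (a * mu psi + nu psi)).
  by rewrite smu snu; ring.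
move=> K kK; have [C1 bC1] := bmu K kK; have [C2 bC2] := bnu K kK.
exists (complex.Re `|a| * C1 + C2) => phi M sK bM.
change (`|a * mu phi + nu phi| <= ((complex.Re `|a| * C1 + C2) * M)%:C).
apply: (le_trans (ler_normD _ _)); rewrite mulrDl rmorphD.
apply: lerD; last exact: bC2.
have e : (complex.Re `|a| * C1 * M)%:C = `|a| * (C1 * M)%:C.
  by rewrite -mulrA [LHS]rmorphM; congr (_ * _); case: a.
by rewrite normrM [leRHS]e ler_wpM2l // bC1.
Qed.

HB.instance Definition _ :=
  GRing.isSubmodClosed.Build R[i] (Cc -> R[i]) radon_pred radon_submod_closed.

Record Radon := MkRadon {
  radon_fun :> Cc -> R[i];
  radon_funP : radon_fun \in radon_pred }.

HB.instance Definition _ := [isSub for radon_fun].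
HB.instance Definition _ := [Choice of Radon by <:].
HB.instance Definition _ := [SubChoice_isSubLmodule of Radon by <:].

(* Pointwise convergence on C_c(R^n), i.e. the weak* topology. *)
HB.instance Definition _ := Topological.copy Radon
  (initial_topology (radon_fun : Radon -> {ptws Cc -> R[i]^o})).

Lemma continuous_RadonP (T : topologicalType) (Psi : T -> Radon) :
  continuous Psi <-> forall phi, continuous (fun x => Psi x phi : R[i]^o).
Proof.
split=> [cPsi phi x|cPsi].
  have c1 : continuous ((radon_fun : Radon -> {ptws Cc -> R[i]^o}) \o Psi).
    by move=> y; apply: continuous_comp; [exact: cPsi|exact: initial_continuous].
  have c2 := @proj_continuous Cc (fun=> R[i]^o) phi.
  exact: (continuous_comp (c1 x) (c2 _)).
apply: (@continuous_comp_initial _ _ {ptws Cc -> R[i]^o}) => x.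
apply/cvg_sup => phi U [_ [[W oW <-] Wx] sWU].
by apply: filterS sWU _; apply: (cPsi phi x); exact: open_nbhs_nbhs.
Qed.

(* The restrictions of mu and nu to C_c(U) agree. *)
Definition radon_eq_on (U : set 'rV[R]_n) (mu nu : Radon) :=
  forall phi : Cc, tsupport phi `<=` U -> mu phi = nu phi.

End RadonMeasures.

(* P is a polynomial of total degree at most d in m real variables, with
   coefficients in the complex vector space W. *)
Definition polynomial_map (R : realType) (m : nat) (W : lmodType R[i]) (d : nat)
    (P : 'rV[R]_m -> W) :=
  exists c : {ffun 'I_m -> 'I_d.+1} -> W, forall v,
    P v = \sum_(alpha : {ffun 'I_m -> 'I_d.+1} | (\sum_i alpha i <= d)%N)
            (\prod_i v 0 i ^+ alpha i)%:C *: c alpha.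

Section LocalFunctionals.
Context (R : realType) (n : nat).
Implicit Types Psi : Conv R n -> Radon R n.

Definition local_functional Psi :=
  forall (U : set 'rV[R]_n) (f h : Conv R n), open U ->
    (forall x, U x -> f x = h x) -> radon_eq_on U (Psi f) (Psi h).

Definition polynomial_functional d Psi :=
  forall f : Conv R n, polynomial_map d (fun v => Psi (conv_affine f v)).

Definition homogeneous_functional k Psi :=
  forall (t : {nonneg R}) (f : Conv R n),
    Psi (conv_scale t f) = (t%:num ^+ k)%:C *: Psi f.

Definition PLV d : {pred Conv R n -> Radon R n} :=
  fun Psi => `[< [/\ continuous Psi, local_functional Psi &
                     polynomial_functional d Psi] >].

Definition PLVk d k : {pred Conv R n -> Radon R n} :=
  fun Psi => (Psi \in PLV d) && `[< homogeneous_functional k Psi >].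

Lemma PLV_submod_closed d : submod_closed (PLV d).
Proof.
split.
  apply/asboolP; split.
  - by apply/continuous_RadonP => phi; exact: (@cst_continuous _ R[i]^o 0).
  - by move=> U f h _ _ phi _.
  - move=> f; exists (fun=> 0) => v.
    by rewrite big1 // => alpha _; rewrite scaler0.
move=> a Psi Xi /asboolP[/continuous_RadonP cP lP pP].
move=> /asboolP[/continuous_RadonP cX lX pX].
apply/asboolP; split.
- apply/continuous_RadonP => phi.
  exact: continuous_lincomb (cP phi) (cX phi).
- move=> U f h oU fh phi sU.
  change (a * Psi f phi + Xi f phi = a * Psi h phi + Xi h phi).
  by rewrite (lP U f h) // (lX U f h).
- move=> f; have [c1 e1] := pP f; have [c2 e2] := pX f.
  exists (fun alpha => a *: c1 alpha + c2 alpha) => v.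
  change (a *: Psi (conv_affine f v) + Xi (conv_affine f v) =
    \sum_(alpha : {ffun 'I_(n + 1) -> 'I_d.+1} | (\sum_i alpha i <= d)%N)
      (\prod_i v 0 i ^+ alpha i)%:C *: (a *: c1 alpha + c2 alpha)).
  rewrite e1 e2 scaler_sumr -big_split /=; apply: eq_bigr => alpha _.
  by rewrite scalerDr !scalerA mulrC.
Qed.

HB.instance Definition _ d := GRing.isSubmodClosed.Build
  R[i] (Conv R n -> Radon R n) (PLV d) (PLV_submod_closed d).

Lemma PLVk_submod_closed d k : submod_closed (PLVk d k).
Proof.
split.
  by apply/andP; split; [exact: rpred0|apply/asboolP => t f; rewrite scaler0].
move=> a Psi Xi /andP[P1 /asboolP hP] /andP[X1 /asboolP hX].
apply/andP; split; first by rewrite rpredD // rpredZ.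
apply/asboolP => t f.
change (a *: Psi (conv_scale t f) + Xi (conv_scale t f) =
  (t%:num ^+ k)%:C *: (a *: Psi f + Xi f)).
by rewrite hP hX scalerDr !scalerA mulrC.
Qed.

HB.instance Definition _ d k := GRing.isSubmodClosed.Build
  R[i] (Conv R n -> Radon R n) (PLVk d k) (PLVk_submod_closed d k).

End LocalFunctionals.

Definition is_direct_sum (K : pzRingType) (V : lmodType K) (I : finType)
    (W : submodClosed V) (Ws : I -> submodClosed V) : Prop :=
  (forall v : V, v \in W <->
     exists2 w : I -> V, (forall i, w i \in Ws i) & v = \sum_i w i) /\
  (forall w : I -> V, (forall i, w i \in Ws i) -> \sum_i w i = 0 ->
     forall i, w i = 0).

(* Main.v *)
(* Let D_g denote the difference operator (D_g F)(f) = F(f + g) - F(f). Replacing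
   a maximum of affine functions by n + d + 1 generically perturbed copies, at
   most n of them fail to be affine near any given point, since n + 1 of the
   equations between two pieces have no common solution in R^n. Near each point
   the difference of Psi along these copies therefore contains d + 1 differences
   in affine directions and vanishes, by locality and by polynomiality of degree
   at most d. Maxima of affine functions approximate every convex function
   locally uniformly, so by continuity D_f^(n+d+1) Psi = 0 for every f. Applied to
   t |-> Psi(t f), this is the Frechet equation, whose continuous solutions are
   the polynomials of degree at most n + d in t; their coefficients, recovered from
   Psi(0), Psi(f), ..., Psi((n+d) f) by inverting a Vandermonde matrix, are the
   homogeneous components. *)
Require Import Defs.
From HB Require Import structures.
From mathcomp Require Import all_boot all_order all_algebra.
From mathcomp Require Import all_classical all_reals all_analysis.
From mathcomp Require Import complex ring lra.

Set Implicit Arguments.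
Unset Strict Implicit.
Unset Printing Implicit Defensive.

Import Order.TTheory GRing.Theory Num.Theory.
Import numFieldNormedType.Exports.

Local Open Scope classical_set_scope.
Local Open Scope ring_scope.
Local Open Scope complex_scope.

(** * Iterated differences *)

Section Differences.

(** The source is only a commutative monoid because convex functions can be added but not
    subtracted. *)
Fixpoint fdiff (M : nmodType) (W : zmodType) (Phi : M -> W) (fs : seq M) (g : M) : W :=
  if fs is f :: fs' then fdiff Phi fs' (g + f) - fdiff Phi fs' g else Phi g.

Definition delta (M : nmodType) (W : zmodType) (f : M) (Phi : M -> W) (g : M) : W :=
  Phi (g + f) - Phi g.

Lemma subr_interchange (W : zmodType) (a b c e : W) :
  (a - b) - (c - e) = (a - c) - (b - e).
Proof. by rewrite !opprD !opprK addrACA. Qed.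

(** Difference operators commute: [fdiff] applies its first direction last, while inductions that
    change the function need it applied first. *)
Lemma fdiff_delta (M : nmodType) (W : zmodType) (Phi : M -> W) f fs g :
  fdiff (delta f Phi) fs g = fdiff Phi (f :: fs) g.
Proof.
elim: fs g => [//|f' fs IH] g.
by rewrite /= !IH /= subr_interchange [g + f' + f]addrAC.
Qed.

Lemma eq_fdiff (M : nmodType) (W : zmodType) (Phi Psi : M -> W) fs :
  Phi =1 Psi -> fdiff Phi fs =1 fdiff Psi fs.
Proof. by move=> e; elim: fs => [|f fs IH] g //=; rewrite !IH. Qed.

Lemma fdiff_comp (M M' : nmodType) (W : zmodType) (Phi : M' -> W) (h : M -> M') fs g :
  {morph h : x y / x + y} -> fdiff Phi (map h fs) (h g) = fdiff (Phi \o h) fs g.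
Proof. by move=> hD; elim: fs g => [//|f fs IH] g /=; rewrite -hD !IH. Qed.

Lemma fdiff_raddf (M : nmodType) (W W' : zmodType) (k : W -> W') (Phi : M -> W) fs g :
  {morph k : x y / x - y} -> k (fdiff Phi fs g) = fdiff (k \o Phi) fs g.
Proof. by move=> kB; elim: fs g => [//|f fs IH] g /=; rewrite kB !IH. Qed.

Lemma fdiffD (M : nmodType) (W : zmodType) (Phi Psi : M -> W) fs g :
  fdiff (fun x => Phi x + Psi x) fs g = fdiff Phi fs g + fdiff Psi fs g.
Proof.
by elim: fs g => [//|f fs IH] g /=; rewrite !IH opprD addrACA.
Qed.

Lemma fdiffB (M : nmodType) (W : zmodType) (Phi Psi : M -> W) fs g :
  fdiff (fun x => Phi x - Psi x) fs g = fdiff Phi fs g - fdiff Psi fs g.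
Proof.
by elim: fs g => [//|f fs IH] g /=; rewrite !IH subr_interchange.
Qed.

Lemma fdiff_sum (M : nmodType) (W : zmodType) (I : finType) (p : pred I)
    (F : I -> M -> W) fs g :
  fdiff (fun x => \sum_(i | p i) F i x) fs g = \sum_(i | p i) fdiff (F i) fs g.
Proof.
by elim: fs g => [//|f fs IH] g /=; rewrite !IH sumrB.
Qed.

(** Fréchet's notion of a polynomial map. The strict bound lets [c = 0] mean that [P] vanishes
    identically. *)
Definition degree_lt (M : nmodType) (W : zmodType) (c : nat) (P : M -> W) :=
  forall ws v, size ws = c -> fdiff P ws v = 0.

Lemma degree_ltS (M : nmodType) (W : zmodType) c (P : M -> W) :
  degree_lt c.+1 P <-> forall w, degree_lt c (delta w P).
Proof.
split=> [hP w ws v sz|hP [//|w ws] v [sz]]; last by rewrite -fdiff_delta hP.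
by rewrite fdiff_delta hP //= sz.
Qed.

Lemma degree_ltW (M : nmodType) (W : zmodType) c c' (P : M -> W) :
  (c <= c')%N -> degree_lt c P -> degree_lt c' P.
Proof.
move=> /subnK <-; elim: (c' - c)%N => [//|k IH] hP [//|w ws] v [sz] /=.
by rewrite !IH // subrr.
Qed.

Lemma eq_degree_lt (M : nmodType) (W : zmodType) c (P Q : M -> W) :
  degree_lt c P -> P =1 Q -> degree_lt c Q.
Proof. by move=> hP e ws v sz; rewrite -(eq_fdiff ws e) hP. Qed.

Lemma degree_lt0 (M : nmodType) (W : zmodType) c (P : M -> W) :
  (forall x, P x = 0) -> degree_lt c P.
Proof.
move=> P0; apply: (degree_ltW (leq0n c)) => ws v /size0nil ->; exact: P0.
Qed.

Lemma degree_lt_cst (M : nmodType) (W : zmodType) (a : W) :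
  degree_lt 1 (fun _ : M => a).
Proof. by case=> [//|w [|//]] v _ /=; rewrite subrr. Qed.

Lemma degree_lt_additive (M : nmodType) (W : zmodType) (P : M -> W) :
  {morph P : x y / x + y} -> degree_lt 2 P.
Proof.
move=> PD; apply/degree_ltS => w; apply: (eq_degree_lt (degree_lt_cst (P w))).
by move=> v; rewrite /delta PD addrC addKr.
Qed.

Lemma degree_ltD (M : nmodType) (W : zmodType) c (P Q : M -> W) :
  degree_lt c P -> degree_lt c Q -> degree_lt c (fun x => P x + Q x).
Proof. by move=> hP hQ ws v sz; rewrite fdiffD hP // hQ // addr0. Qed.

Lemma degree_ltB (M : nmodType) (W : zmodType) c (P Q : M -> W) :
  degree_lt c P -> degree_lt c Q -> degree_lt c (fun x => P x - Q x).
Proof. by move=> hP hQ ws v sz; rewrite fdiffB hP // hQ // subr0. Qed.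

Lemma degree_lt_sum (M : nmodType) (W : zmodType) (I : finType) (p : pred I) c
    (F : I -> M -> W) :
  (forall i, p i -> degree_lt c (F i)) ->
  degree_lt c (fun x => \sum_(i | p i) F i x).
Proof.
by move=> hF ws v sz; rewrite fdiff_sum big1 // => i pi; exact: hF.
Qed.

Lemma degree_lt_shift (M : nmodType) (W : zmodType) c w (P : M -> W) :
  degree_lt c P -> degree_lt c (fun x => P (x + w)).
Proof.
move=> hP ws v sz; rewrite -[RHS](hP ws (v + w)) //.
by elim: ws v {hP sz} => [//|f fs IH] v /=; rewrite !IH addrAC.
Qed.

(** By the Leibniz rule, a difference of [P * Q] is a sum of two products in each of which one
    factor has lost a degree; the induction is on [a + b]. *)
Lemma degree_ltM (M : nmodType) (W : comPzRingType) a b (P Q : M -> W) :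
  degree_lt a.+1 P -> degree_lt b.+1 Q ->
  degree_lt (a + b).+1 (fun x => P x * Q x).
Proof.
elim: {a b}(a + b)%N {-2}a {-2}b (erefl (a + b)%N) P Q => [|m IH] a b.
  case: a b => [|//] [|//] _ P Q hP hQ; apply/degree_ltS => w.
  move/degree_ltS: hP => hP; move/degree_ltS: hQ => hQ.
  apply: degree_lt0 => x.
  have := hP w [::] x erefl; have := hQ w [::] x erefl.
  by rewrite /= /delta => /subr0_eq -> /subr0_eq ->; rewrite subrr.
move=> eab P Q hP hQ; apply/degree_ltS => w.
move/degree_ltS: (hP) => dP; move/degree_ltS: (hQ) => dQ.
apply: (@eq_degree_lt _ _ _ (fun x => delta w P x * Q (x + w) + P x * delta w Q x)); last first.
  by move=> x; rewrite /delta; ring.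
apply: degree_ltD.
- case: a eab hP dP => [|a] eab hP dP.
    by apply: degree_lt0 => x; have /= -> := dP w [::] x erefl; rewrite mul0r.
  have e : (a + b)%N = m by move: eab; rewrite addSn => -[].
  by apply: (IH a b e) => //; exact: degree_lt_shift.
- case: b eab hQ dQ => [|b] eab hQ dQ.
    by apply: degree_lt0 => x; have /= -> := dQ w [::] x erefl; rewrite mulr0.
  have e : (a + b)%N = m by move: eab; rewrite addnS => -[].
  by rewrite addnS; apply: (IH a b e).
Qed.

Lemma degree_ltX (M : nmodType) (W : comPzRingType) k (P : M -> W) :
  degree_lt 2 P -> degree_lt k.+1 (fun x => P x ^+ k).
Proof.
move=> hP; elim: k => [|k IH].
  by apply: (eq_degree_lt (degree_lt_cst 1)) => x; rewrite expr0.
by apply: (eq_degree_lt (degree_ltM hP IH)) => x; rewrite exprS.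
Qed.

Lemma degree_lt_prod (M : nmodType) (W : comPzRingType) (I : finType) (a : I -> nat)
    (F : I -> M -> W) :
  (forall i, degree_lt (a i).+1 (F i)) ->
  degree_lt (\sum_i a i).+1 (fun x => \prod_i F i x).
Proof.
move=> hF.
have -> : (fun x => \prod_i F i x) =
    (\big[(fun P Q x => P x * Q x)/(fun _ => 1)]_i F i).
  by apply/funext => x; elim/big_rec2: _ => // i P Q _ ->.
elim/big_rec2: _ => [|i s P _ hP]; first exact: degree_lt_cst.
exact: degree_ltM.
Qed.

(** The N-th forward difference is [u (k + N)] plus an integer combination of the N preceding
    values, which all vanish here. *)
Lemma fdiff_nseq1_recurrence (W : zmodType) (u : nat -> W) N k :
  (forall j, (j < N)%N -> u (k + j)%N = 0) -> fdiff u (nseq N 1%N) k = u (k + N)%N.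
Proof.
elim: N k => [|N IH] k u0 /=; first by rewrite addn0.
rewrite IH => [|j jN]; last first.
  by rewrite -addnA add1n u0.
rewrite IH => [|j jN]; last by rewrite u0 // ltnW.
by rewrite u0 // subr0 -addnA add1n.
Qed.

(** A vanishing N-th difference is a recurrence of order N, so N initial zeros propagate. *)
Lemma fdiff_nseq1_eq0 (W : zmodType) (u : nat -> W) N :
  (forall k, fdiff u (nseq N 1%N) k = 0) -> (forall j, (j < N)%N -> u j = 0) ->
  forall k, u k = 0.
Proof.
move=> du u0 k; elim/ltn_ind: k => k IH.
case: (ltnP k N) => [/u0 //|Nk].
have := @fdiff_nseq1_recurrence _ u N (k - N)%N.
rewrite subnK // du => <- // j jN; apply: IH.
by rewrite -ltn_subRL subKn.
Qed.

Lemma degree_lt_horner (F : idomainType) (p : {poly F}) N (h : F) : (size p <= N)%N ->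
  degree_lt N (fun k : nat => p.[h * k%:R]).
Proof.
move=> sp; apply: (@eq_degree_lt _ _ _
    (fun k : nat => \sum_(i < size p) p`_i * (h * k%:R) ^+ i)); last first.
  by move=> k; rewrite horner_coef.
apply: degree_lt_sum => i _.
have lin : degree_lt 2 (fun k : nat => h * k%:R).
  by apply: degree_lt_additive => x y; rewrite natrD mulrDr.
apply: (@degree_ltW _ _ (0 + i).+1); first exact: leq_trans (ltn_ord i) sp.
apply: (@degree_ltM nat F 0 i (fun=> p`_i) (fun k : nat => (h * k%:R) ^+ i)).
  exact: degree_lt_cst.
exact: degree_ltX.
Qed.

End Differences.

(** * Lagrange interpolation through the Vandermonde matrix *)

Section Interpolation.
Variable F : fieldType.

Lemma Vandermonde_unitmx N (x : 'rV[F]_N) :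
  injective (x 0) -> Vandermonde N x \in unitmx.
Proof.
move=> xI; rewrite unitmxE det_Vandermonde unitfE.
apply/prodf_neq0 => i _; apply/prodf_neq0 => j ij.
by rewrite subr_eq0 (inj_eq xI) gt_eqF.
Qed.

Lemma interpolation N (x y : 'rV[F]_N) : injective (x 0) ->
  exists2 p : {poly F}, (size p <= N)%N & forall j, p.[x 0 j] = y 0 j.
Proof.
move=> /Vandermonde_unitmx uV; pose a := y *m invmx (Vandermonde N x).
exists (rVpoly a); first exact: size_poly.
move=> j; rewrite (horner_coef_wide _ (size_poly _ _)).
rewrite -[in RHS](mulmxKV uV y) mxE; apply: eq_bigr => i _.
by rewrite -[\poly_(_ < _) _]/(rVpoly a) coef_rVpoly_ord [Vandermonde _ _ _ _]mxE.
Qed.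

End Interpolation.

Lemma near_le_of_lt (R : realType) (T : topologicalType) (f g : T -> R) x :
  {for x, continuous f} -> {for x, continuous g} -> f x < g x ->
  \forall y \near x, f y <= g y.
Proof.
move=> cf cg; rewrite -subr_gt0 => d0.
near=> y; apply/ltW; rewrite -subr_gt0; near: y.
exact: (cvgr_gt _ (cvgB cg cf) _ d0).
Unshelve. all: by end_near. Qed.

(** * Convex functions and maxima of affine functions *)

Section ConvexFunctions.
Variables (R : realType) (n : nat).
Implicit Types (f g : Conv R n) (x y : 'rV[R]_n) (v w : 'rV[R]_(n + 1)).

Lemma convex_predP (f : 'rV[R]_n -> R) : f \in @convex_pred R n <->
  forall t x y, 0 <= t <= 1 ->
    f (t *: x + (1 - t) *: y) <= t * f x + (1 - t) * f y.
Proof.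
split=> [/asboolP cf t x y /andP[t0 t1]|cf].
  exact: (cf (Itv01 t0 t1) x y (mem_setT _) (mem_setT _)).
apply/asboolP => t x y _ _; apply: cf; exact/andP.
Qed.

Lemma Conv_convex f t x y : 0 <= t <= 1 ->
  f (t *: x + (1 - t) *: y) <= t * f x + (1 - t) * f y.
Proof. by move: t x y; apply/convex_predP; exact: conv_funP. Qed.

Lemma conv_inj f g : f =1 g -> f = g.
Proof. by move=> e; apply: val_inj; exact/funext. Qed.

Lemma conv_zero_subproof : (fun=> 0) \in @convex_pred R n.
Proof. by apply/convex_predP => t x y _; rewrite !mulr0 addr0. Qed.

Lemma conv_add_subproof f g : (fun x => f x + g x) \in @convex_pred R n.
Proof.
apply/convex_predP => t x y t01; rewrite !mulrDr addrACA.
by rewrite lerD // Conv_convex.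
Qed.

Definition conv_zero : Conv R n := MkConv conv_zero_subproof.
Definition conv_add f g : Conv R n := MkConv (conv_add_subproof f g).

Lemma conv_addA : associative conv_add.
Proof. by move=> f g h; apply: conv_inj => x /=; rewrite addrA. Qed.

Lemma conv_addC : commutative conv_add.
Proof. by move=> f g; apply: conv_inj => x /=; rewrite addrC. Qed.

Lemma conv_add0 : left_id conv_zero conv_add.
Proof. by move=> f; apply: conv_inj => x /=; rewrite add0r. Qed.

HB.instance Definition _ :=
  GRing.isNmodule.Build (Conv R n) conv_addA conv_addC conv_add0.

Lemma conv_addE f g x : (f + g) x = f x + g x. Proof. by []. Qed.

Lemma affine_funD v w x : affine_fun (v + w) x = affine_fun v x + affine_fun w x.
Proof.
rewrite /affine_fun addrACA -big_split /=; congr (_ + _); last by rewrite !mxE.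
by apply: eq_bigr => i _; rewrite !mxE mulrDl.
Qed.

Lemma affine_fun0 x : affine_fun (0 : 'rV_(n + 1)) x = 0.
Proof.
by rewrite /affine_fun !mxE addr0 big1 // => i _; rewrite !mxE mul0r.
Qed.

Definition aff v : Conv R n := conv_affine 0 v.

Lemma affE v x : aff v x = affine_fun v x.
Proof. by rewrite /= add0r. Qed.

Lemma conv_affineE f v : conv_affine f v = f + aff v.
Proof. by apply: conv_inj => x /=; rewrite add0r. Qed.

Lemma affD : {morph aff : v w / v + w}.
Proof. by move=> v w; apply: conv_inj => x /=; rewrite !add0r affine_funD. Qed.

Lemma aff0 : aff 0 = 0.
Proof. by apply: conv_inj => x; rewrite affE affine_fun0. Qed.

Lemma affine_fun_continuous v : continuous (affine_fun v : 'rV[R]_n -> R).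
Proof.
have c1 i : continuous (fun x : 'rV[R]_n => lsubmx v 0 i * x 0 i).
  by move=> x; exact: (cvgM (cvg_cst _) (@coord_continuous R 1 n 0 i x)).
have c2 : continuous (fun x : 'rV[R]_n => \sum_(i < n) lsubmx v 0 i * x 0 i).
  by apply: (continuous_big add_continuous) => i _; exact: c1.
by move=> x; exact: (cvgD (c2 x) (cvg_cst _)).
Qed.

(** The family is nonempty, so its first member can start the maximum and no bottom element
    enters. *)
Definition maxaff m (v : 'I_m.+1 -> 'rV[R]_(n + 1)) x : R :=
  \big[Num.max/affine_fun (v ord0) x]_i affine_fun (v i) x.

Lemma le_maxaff m (v : 'I_m.+1 -> 'rV[R]_(n + 1)) i x :
  affine_fun (v i) x <= maxaff v x.
Proof. exact: le_bigmax. Qed.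

Lemma maxaff_le m (v : 'I_m.+1 -> 'rV[R]_(n + 1)) x b :
  (forall i, affine_fun (v i) x <= b) -> maxaff v x <= b.
Proof. by move=> h; apply: bigmax_le. Qed.

Lemma maxaff_convex m (v : 'I_m.+1 -> 'rV[R]_(n + 1)) :
  maxaff v \in @convex_pred R n.
Proof.
apply/convex_predP => t x y t01; apply: maxaff_le => i.
rewrite -affE; apply: (le_trans (Conv_convex _ _ _ t01)); rewrite !affE.
by case/andP: t01 => t0 t1; rewrite lerD // ler_wpM2l ?le_maxaff // subr_ge0.
Qed.

Definition conv_max m (v : 'I_m.+1 -> 'rV[R]_(n + 1)) : Conv R n :=
  MkConv (maxaff_convex v).

(** Without ties at [x] the maximal piece is strictly above the others there, and by continuity it
    stays above them nearby. *)
Lemma maxaff_affine_near m (v : 'I_m.+1 -> 'rV[R]_(n + 1)) x :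
  (forall i j, i != j -> affine_fun (v i) x != affine_fun (v j) x) ->
  exists i, \forall y \near x, maxaff v y = affine_fun (v i) y.
Proof.
move=> vx; pose i := [arg max_(i > ord0 | true) affine_fun (v i) x]%O.
have iP j : affine_fun (v j) x <= affine_fun (v i) x.
  by rewrite /i; case: arg_maxP => // k _ h; exact: h.
exists i.
have near_le j : \forall y \near x, affine_fun (v j) y <= affine_fun (v i) y.
  have [->|ji] := eqVneq j i; first exact: (@nearW _ (nbhs x) _ _ (fun=> lexx _)).
  apply: near_le_of_lt; [exact: affine_fun_continuous|exact: affine_fun_continuous|].
  by rewrite lt_neqAle vx //= iP.
near=> y; apply/le_anti/andP; split; last exact: le_maxaff.
apply: maxaff_le; near: y.
exact: (@filter_forall _ _ (fun j y => affine_fun (v j) y <= affine_fun (v i) y)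
  (nbhs x) _ near_le).
Unshelve. all: by end_near. Qed.

End ConvexFunctions.

(** * Generic vertical perturbations of the affine pieces *)

Section GenericPerturbation.
Variables (R : realType) (n : nat).
Implicit Types (x y : 'rV[R]_n) (v w : 'rV[R]_(n + 1)).

Definition level (c : R) : 'rV[R]_(n + 1) := row_mx 0 (const_mx c).

Lemma affine_fun_level c x : affine_fun (level c) x = c.
Proof.
rewrite /affine_fun /level row_mxKl row_mxKr mxE big1 ?add0r // => i _.
by rewrite mxE mul0r.
Qed.

Lemma nonroot (Q : {poly R}) (eta : R) : Q != 0 -> 0 < eta ->
  exists2 s, 0 < s < eta & ~~ root Q s.
Proof.
(* These [size Q] distinct points exceed the possible number of roots; denominators from 2 on keep
   them strictly below [eta]. *)
move=> Q0 eta0; pose a (k : nat) : R := eta / k.+2%:R.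
have a_inj : injective a.
  move=> i j /(mulfI (lt0r_neq0 eta0)) /invr_inj /eqP.
  by rewrite eqr_nat => /eqP[].
have [/allP ra|/allPn[s /mapP[k _ ->] rs]] :=
    boolP (all (root Q) [seq a k | k <- iota 0 (size Q)]).
  have := max_poly_roots Q0 (introT allP ra).
  by rewrite map_inj_uniq // iota_uniq size_map size_iota ltnn => /(_ isT).
exists (a k) => //; rewrite divr_gt0 //= ltr_pdivrMr ?ltr0n //.
by rewrite ltr_pMr // ltr1n.
Qed.

(* A configuration assigns to each of the n+1 labels k a copy (tau k).1 of the
   perturbed maximum and a pair (tau k).2 of its pieces. The n+1 differences of
   slopes are linearly dependent, so the tie equations of a configuration are
   only compatible when the perturbation is a root of a nonzero polynomial. *)
Lemma generic_perturbation m N (v : 'I_m.+1 -> 'rV[R]_(n + 1)) (eta : R) :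
  0 < eta ->
  exists2 eps : 'I_m.+1 -> 'I_N -> R, (forall i j, 0 <= eps i j <= eta) &
    forall x (jj : 'I_n.+1 -> 'I_N), injective jj ->
      ~ forall k, exists i i', i != i' /\
          affine_fun (v i + level (eps i (jj k))) x =
          affine_fun (v i' + level (eps i' (jj k))) x.
Proof.
move=> eta0.
pose T := {ffun 'I_n.+1 -> 'I_N * ('I_m.+1 * 'I_m.+1)}.
(* Piece [i] of copy [j] is raised by [s ^+ code i j]. Distinct exponents keep the monomials apart,
   and exponents from 1 on avoid the constant term and give powers at most [s]. *)
pose code (i : 'I_m.+1) (j : 'I_N) : nat := (enum_rank (i, j)).+1.
have code_inj i j i' j' : code i j = code i' j' -> i = i' /\ j = j'.
  by move=> [/ord_inj/enum_rank_inj[-> ->]].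
pose D (tau : T) : 'M[R]_(n.+1, n) :=
  \matrix_k (lsubmx (v (tau k).2.1) - lsubmx (v (tau k).2.2)).
(* The matrix [D tau] has n + 1 rows and n columns, so its left kernel is nonzero. *)
pose lam (tau : T) : 'rV[R]_n.+1 := nz_row (kermx (D tau)).
have lam_neq0 tau : lam tau != 0.
  rewrite nz_row_eq0 -mxrank_eq0 mxrank_ker subn_eq0 -ltnNge ltnS.
  exact: rank_leq_col.
have lamD tau : lam tau *m D tau = 0.
  by apply/sub_kermxP; exact: nz_row_sub.
(* Combining the tie equations with weights [lam tau] eliminates [x] and leaves a polynomial
   condition on [s]. *)
pose q (tau : T) : {poly R} := \sum_k lam tau 0 k *:
  ((rsubmx (v (tau k).2.1) 0 0 - rsubmx (v (tau k).2.2) 0 0)%:P +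
   'X^(code (tau k).2.1 (tau k).1) - 'X^(code (tau k).2.2 (tau k).1)).
pose good (tau : T) := injectiveb (fun k => (tau k).1) &&
  [forall k, (tau k).2.1 != (tau k).2.2].
have q_neq0 tau : good tau -> q tau != 0.
  move=> /andP[/injectiveP tauI /forallP tau2].
  have /rV0Pn[k lk] := lam_neq0 tau.
  (* The copies of a good configuration are distinct, and so are the two pieces of each label, so
     this monomial occurs only once, with coefficient [lam tau 0 k]. *)
  apply/eqP => /(congr1 (coefp (code (tau k).2.1 (tau k).1))).
  rewrite /coefp coef0 coef_sum (bigD1 k) //= big1 => [|k' k'k]; last first.
    rewrite coefZ !coefD coefN coefC !coefXn /=.
    case: eqP => [/code_inj[_ /tauI e]|_]; first by rewrite e eqxx in k'k.
    case: eqP => [/code_inj[_ /tauI e]|_]; first by rewrite e eqxx in k'k.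
    by rewrite addr0 subr0 mulr0.
  rewrite coefZ !coefD coefN coefC !coefXn /= eqxx.
  case: eqP => [/code_inj[e _]|_]; first by move: (tau2 k); rewrite e eqxx.
  by rewrite add0r subr0 mulr1 addr0 => /eqP; rewrite (negbTE lk).
pose Q := \prod_(tau | good tau) q tau.
have Q0 : Q != 0 by apply/prodf_neq0 => tau; exact: q_neq0.
have eta1 : 0 < Num.min 1 eta by rewrite lt_min ltr01.
have [s /andP[s0]] := nonroot Q0 eta1.
rewrite lt_min => /andP[s1 seta] rQ.
exists (fun i j => s ^+ code i j) => [i j|x jj jjI tie].
  apply/andP; split; first exact/exprn_ge0/ltW.
  apply: le_trans (ltW seta); rewrite /code exprS ler_piMr //; first exact: ltW.
  by apply: exprn_ile1; exact: ltW.
have /choice[p hp] : forall k, exists p : 'I_m.+1 * 'I_m.+1, p.1 != p.2 /\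
    affine_fun (v p.1 + level (s ^+ code p.1 (jj k))) x =
    affine_fun (v p.2 + level (s ^+ code p.2 (jj k))) x.
  by move=> k; have [i [i' h]] := tie k; exists (i, i').
pose tau : T := [ffun k => (jj k, p k)].
have gtau : good tau.
  apply/andP; split.
    by apply/injectiveP => k k'; rewrite !ffunE; exact: jjI.
  by apply/forallP => k; rewrite ffunE; case: (hp k).
move/negP: rQ; apply; rewrite /Q (bigD1 tau) //= rootM; apply/orP; left.
(* By the tie equations, each bracket of [q tau] at [s] is minus the slope difference applied to
   [x]. *)
have -> : root (q tau) s = (- (lam tau *m D tau *m x^T) 0 0 == 0).
  rewrite rootE /q horner_sum -mulmxA mxE -sumrN; congr (_ == 0).
  apply: eq_bigr => k _; rewrite !hornerE -mulrN; congr (_ * _).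
  have [_] := hp k; rewrite !affine_funD !affine_fun_level /affine_fun.
  rewrite !mxE /tau ffunE /= => h.
  have -> : \sum_j D tau k j * x^T j 0 =
      \sum_(i < n) lsubmx (v (p k).1) 0 i * x 0 i -
      \sum_(i < n) lsubmx (v (p k).2) 0 i * x 0 i.
    rewrite -sumrB; apply: eq_bigr => j _.
    by rewrite /D /tau !mxE ffunE /= mulrBl.
  by move: h; lra.
by rewrite lamD mul0mx mxE oppr0.
Qed.

End GenericPerturbation.

(** * Approximation of convex functions *)

Section Approximation.
Variables (R : realType) (n : nat).
Implicit Types (f : Conv R n) (x y : 'rV[R]_n) (v w : 'rV[R]_(n + 1)).

Definition dot (a y : 'rV[R]_n) : R := \sum_i a 0 i * y 0 i.

Lemma dotDZr a y z (r : R) : dot a (y + r *: z) = dot a y + r * dot a z.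
Proof.
rewrite /dot mulr_sumr -big_split; apply: eq_bigr => i _ /=.
by rewrite !mxE; ring.
Qed.

Lemma dotDZl a b y (r : R) : dot (a + r *: b) y = dot a y + r * dot b y.
Proof.
rewrite /dot mulr_sumr -big_split; apply: eq_bigr => i _ /=.
by rewrite !mxE; ring.
Qed.

Lemma dot0r a : dot a 0 = 0.
Proof. by rewrite /dot big1 // => i _; rewrite mxE mulr0. Qed.

Lemma dot_deltal j y : dot (delta_mx 0 j) y = y 0 j.
Proof.
rewrite /dot (bigD1 j) //= big1 => [|i ij]; rewrite !mxE ?eqxx ?mul1r ?addr0 //.
by rewrite (negbTE ij) mul0r.
Qed.

Lemma dot_deltar j a : dot a (delta_mx 0 j) = a 0 j.
Proof. by rewrite -[RHS]dot_deltal /dot; apply: eq_bigr => i _; rewrite mulrC. Qed.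

Lemma conv_le_max f (t : R) x y : 0 <= t <= 1 ->
  f (t *: x + (1 - t) *: y) <= Num.max (f x) (f y).
Proof.
move=> t01; apply: le_trans (Conv_convex _ _ _ t01) _.
case/andP: t01 => t0 t1.
have h1 : f x <= Num.max (f x) (f y) by rewrite le_max lexx.
have h2 : f y <= Num.max (f x) (f y) by rewrite le_max lexx orbT.
by set M := Num.max _ _ in h1 h2 *; nra.
Qed.

(* By induction on the number of nonzero coordinates of y: x0 + y is the midpoint
   of a point with one coordinate less and a point of an axis through x0. *)
Lemma conv_bounded_above_cube f x0 (rho : R) : 0 < rho ->
  exists M, forall y, (forall i, `|y 0 i| <= rho) -> f (x0 + y) <= M.
Proof.
suff H (k : nat) : forall rho : R, 0 < rho -> exists M, forall y,
    (forall i : 'I_n, (k <= i)%N -> y 0 i = 0) -> (forall i, `|y 0 i| <= rho) ->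
    f (x0 + y) <= M.
  move=> r0; have [M hM] := H n rho r0; exists M => y yr; apply: hM => // i.
  by rewrite leqNgt ltn_ord.
elim: k => [|k IH] {}rho r0.
  exists (f x0) => y y0 _; have -> : y = 0 by apply/rowP => i; rewrite y0 // mxE.
  by rewrite addr0.
have [kn|nk] := ltnP k n; last first.
  have [M hM] := IH rho r0; exists M => y y0 yr; apply: hM => // i ki.
  by have := leq_trans (ltn_ord i) (leq_trans nk ki); rewrite ltnn.
pose j := Ordinal kn; pose e : 'rV[R]_n := delta_mx 0 j.
(* Both endpoints of the midpoint decomposition involve twice the coordinates of [y], hence the
   doubled radius. *)
have [M hM] := IH (2 * rho) (mulr_gt0 (ltr0Sn R 1) r0).
exists (Num.max M (Num.max (f (x0 + (2 * rho) *: e)) (f (x0 - (2 * rho) *: e)))).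
move=> y y0 yr; pose y' := y - y 0 j *: e.
have -> : x0 + y = 2^-1 *: (x0 + 2 *: y') + (1 - 2^-1) *: (x0 + (2 * y 0 j) *: e).
  by apply/rowP => i; rewrite !mxE; field.
apply: le_trans (conv_le_max _ _ _ _) _; first by lra.
rewrite ge_max !le_max; apply/andP; split.
  apply/orP; left; apply: hM => i.
    rewrite leq_eqVlt => /orP[/eqP ki|ki].
      by have -> : i = j by [exact: val_inj]; rewrite !mxE !eqxx /=; ring.
    have /negbTE ij : i != j by apply: contraTneq ki => ->; rewrite ltnn.
    by rewrite !mxE (y0 i ki) ij andbF !mulr0 subr0 ?mulr0.
  rewrite !mxE /= normrM ger0_norm // ler_pM2l //.
  have [->|ij] := eqVneq i j; first by rewrite mulr1 subrr normr0 ltW.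
  by rewrite mulr0 subr0.
apply/orP; right; rewrite -le_max.
pose t := (y 0 j + rho) / (2 * rho).
have -> : x0 + (2 * y 0 j) *: e =
    t *: (x0 + (2 * rho) *: e) + (1 - t) *: (x0 - (2 * rho) *: e).
  by apply/rowP => i; rewrite !mxE /t; field; rewrite lt0r_neq0.
apply: conv_le_max; have := yr j; rewrite ler_norml => /andP[h1 h2].
rewrite /t divr_ge0 ?ler_pdivrMr //=; lra.
Qed.

(** A nearby [y] lies on the segment from [x0] to a point of the unit cube around it, where [f] is
    at most [M]; convexity bounds the increase by [t * (M - f x0)]. *)
Lemma conv_usc f x0 (eta : R) : 0 < eta -> \forall y \near x0, f y < f x0 + eta.
Proof.
move=> eta0; have [M hM] := @conv_bounded_above_cube f x0 1 ltr01.
(* The maximum with 1 makes [C] positive even when [M] does not exceed [f x0]. *)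
pose C := Num.max (M - f x0) 1.
have C1 : 1 <= C by rewrite le_max lexx orbT.
have CM : M - f x0 <= C by rewrite le_max lexx.
pose t := Num.min 1 (eta / (2 * C)).
have C0 : 0 < C by exact: lt_le_trans C1.
have t0 : 0 < t by rewrite lt_min ltr01 divr_gt0 // mulr_gt0.
have t1 : t <= 1 by rewrite ge_min lexx.
have tC : t * C <= eta / 2.
  have : t <= eta / (2 * C) by rewrite ge_min lexx orbT.
  rewrite -(ler_pM2r C0) => /le_trans; apply; rewrite le_eqVlt; apply/orP; left.
  by apply/eqP; field; rewrite lt0r_neq0.
apply/nbhs_ballP; exists t => //= y [_ xy].
have -> : y = (1 - (1 - t)) *: (x0 + t^-1 *: (y - x0)) + (1 - t) *: x0.
  by apply/rowP => i; rewrite !mxE; field; rewrite lt0r_neq0.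
rewrite addrC.
apply: le_lt_trans (Conv_convex _ _ _ _) _; first by lra.
have /hM h : forall i, `|(t^-1 *: (y - x0)) 0 i| <= 1.
  move=> i; rewrite !mxE normrM gtr0_norm ?invr_gt0 // ler_pdivrMl // mulr1.
  by rewrite distrC; apply/ltW/xy.
set F := f (x0 + _) in h *.
have : t * (F - f x0) <= t * C by rewrite ler_pM2l //; lra.
have := @ltr0Sn R 1; nra.
Qed.

(* The linear form is extended one coordinate at a time, as in the Hahn-Banach
   theorem. *)
Lemma conv_subgradient f x0 :
  exists2 v, affine_fun v x0 = f x0 & forall x, affine_fun v x <= f x.
Proof.
suff H (k : nat) : exists a, forall y, (forall i : 'I_n, (k <= i)%N -> y 0 i = 0) ->
    dot a y <= f (x0 + y) - f x0.
  have [a ha] := H n.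
  have affE' x : affine_fun (row_mx a (const_mx (f x0 - dot a x0))) x =
      dot a (x - x0) + f x0.
    rewrite -[- x0]scaleN1r dotDZr /affine_fun row_mxKl row_mxKr mxE /dot; ring.
  exists (row_mx a (const_mx (f x0 - dot a x0))) => [|x]; rewrite affE'.
    by rewrite subrr dot0r add0r.
  rewrite -lerBrDr; have := ha (x - x0); rewrite [x0 + _]addrC subrK; apply => i.
  by rewrite leqNgt ltn_ord.
elim: k => [|k [a ha]].
  exists 0 => y y0; have -> : y = 0 by apply/rowP => i; rewrite y0 // mxE.
  by rewrite dot0r addr0 subrr.
have [kn|nk] := ltnP k n; last first.
  exists a => y y0; apply: ha => // i ki.
  by have := leq_trans (ltn_ord i) (leq_trans nk ki); rewrite ltnn.
pose j := Ordinal kn; pose e : 'rV[R]_n := delta_mx 0 j.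
pose V (y : 'rV[R]_n) := forall i : 'I_n, (k <= i)%N -> y 0 i = 0.
pose g y := f (x0 + y) - f x0.
(* Every lower bound for the new slope is at most every upper bound: the weights [r] and [1 - r]
   cancel the component along [e], and the induction hypothesis applies to the resulting point of
   [V]. *)
have key y z s t : V y -> V z -> 0 < s -> 0 < t ->
    (dot a y - g (y - s *: e)) / s <= (g (z + t *: e) - dot a z) / t.
  move=> Vy Vz s0 t0; pose r := t / (s + t).
  have st0 : 0 < s + t by rewrite addr_gt0.
  have Vw : V (r *: y + (1 - r) *: z).
    by move=> i ki; rewrite !mxE Vy // Vz // !mulr0 addr0.
  have dw : dot a (r *: y + (1 - r) *: z) = r * dot a y + (1 - r) * dot a z.
    by rewrite dotDZr -[r *: y]add0r dotDZr dot0r add0r.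
  have := ha _ Vw; rewrite dw.
  have -> : x0 + (r *: y + (1 - r) *: z) =
      r *: (x0 + (y - s *: e)) + (1 - r) *: (x0 + (z + t *: e)).
    by apply/rowP => i; rewrite !mxE /r; field; rewrite lt0r_neq0.
  have r01 : 0 <= r <= 1.
    by rewrite /r divr_ge0 ?(ltW t0) ?(ltW st0) //= ler_pdivrMr // mul1r lerDr ltW.
  have := Conv_convex f (x0 + (y - s *: e)) (x0 + (z + t *: e)) r01.
  rewrite ler_pdivrMr // [_ / t * s]mulrAC ler_pdivlMr // /g.
  set F := f _; set G := f (x0 + (y - _)); set H := f (x0 + (z + _)).
  move=> h1 h2; have := le_trans h2 (lerB h1 (lexx (f x0))).
  have -> : 1 - r = s / (s + t) by rewrite /r; field; rewrite lt0r_neq0.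
  rewrite -(ler_pM2r st0) /r.
  have -> : (t / (s + t) * dot a y + s / (s + t) * dot a z) * (s + t) =
     t * dot a y + s * dot a z by field; rewrite lt0r_neq0.
  have -> : (t / (s + t) * G + s / (s + t) * H - f x0) * (s + t) =
     t * G + s * H - f x0 * (s + t) by field; rewrite lt0r_neq0.
  by lra.
pose A := [set r | exists y s, [/\ V y, 0 < s & r = (dot a y - g (y - s *: e)) / s]].
have V0 : V 0 by move=> i _; rewrite mxE.
have A0 : A !=set0 by exists ((dot a 0 - g (0 - 1 *: e)) / 1); exists 0, 1.
have Aub z t : V z -> 0 < t -> ubound A ((g (z + t *: e) - dot a z) / t).
  by move=> Vz t0 _ [y [s [Vy s0 ->]]]; exact: key.
have supA : has_sup A.
  by split => //; exists ((g (0 + 1 *: e) - dot a 0) / 1); exact: Aub.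
(* The new form agrees with [a] on [V] and takes the value [sup A] on [e]. *)
exists (a + (sup A - a 0 j) *: e) => y y0.
pose r := y 0 j; pose y' := y - r *: e.
have Vy' : V y'.
  move=> i; rewrite leq_eqVlt => /orP[/eqP ki|ki].
    by have -> : i = j by [exact: val_inj]; rewrite !mxE !eqxx /= /r; ring.
  have /negbTE ij : i != j by apply: contraTneq ki => ->; rewrite ltnn.
  by rewrite !mxE (y0 i ki) ij andbF !mulr0 subr0 ?mulr0.
have yE : y = y' + r *: e by rewrite subrK.
have -> : dot (a + (sup A - a 0 j) *: e) y = dot a y' + sup A * r.
  rewrite dotDZl dot_deltal [in dot a y]yE dotDZr dot_deltar -/r; ring.
rewrite -/(g y).
have [r0|r0|r0] := ltgtP r 0.
- have : (dot a y' - g (y' - (- r) *: e)) / (- r) <= sup A.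
    by apply: sup_upper_bound => //; exists y', (- r); rewrite oppr_gt0.
  rewrite ler_pdivrMr ?oppr_gt0 // scaleNr opprK -yE; lra.
- have : sup A <= (g (y' + r *: e) - dot a y') / r.
    by apply: ge_sup => //; exact: Aub.
  rewrite ler_pdivlMr // -yE; lra.
- have := ha _ Vy'; rewrite -/(g y') r0 mulr0 addr0.
  by have <- : y' = y by rewrite [RHS]yE r0 scale0r addr0.
Qed.

(** Each supporting affine function is within [eta] of [f] near its point of contact, and finitely
    many such neighbourhoods cover [K]. *)
Lemma maxaff_approx f (K : set 'rV[R]_n) (eta : R) : compact K -> 0 < eta ->
  exists m (v : 'I_m.+1 -> 'rV[R]_(n + 1)), (forall x, maxaff v x <= f x) /\
    forall x, K x -> f x < maxaff v x + eta.
Proof.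
move=> cK eta0.
have /choice[vp hvp] : forall p, exists v, affine_fun v p = f p /\
    forall x, affine_fun v x <= f x.
  by move=> p; have [v h1 h2] := conv_subgradient f p; exists v.
pose U p := interior [set y | f y < affine_fun (vp p) y + eta].
move: cK; rewrite compact_cover => /(_ _ setT U)[].
- by move=> p _; exact: open_interior.
- move=> p _; exists p => //; rewrite /U /interior /=.
  have eta2 : 0 < eta / 2 by rewrite divr_gt0.
  have [vpp _] := hvp p.
  near=> y.
  have h1 : f y < f p + eta / 2 by near: y; exact: conv_usc.
  have h2 : f p - eta / 2 <= affine_fun (vp p) y.
    near: y; apply: (@near_le_of_lt _ _ (fun=> f p - eta / 2) (affine_fun (vp p))).
    - exact: cst_continuous.
    - exact: affine_fun_continuous.
    by rewrite vpp ltrBlDr ltrDl.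
  by rewrite /=; lra.
move=> D _ KD; pose s : seq 'rV[R]_n := finmap.enum_fset D.
(* The extra point 0 keeps the family nonempty when the subcover is empty; its supporting function
   also stays below [f]. *)
exists (size s), (fun i => vp (nth 0 (0 :: s) i)); split.
  by move=> x; apply: maxaff_le => i; have [_] := hvp (nth 0 (0 :: s) i); exact.
move=> x /KD[p /= pD /interior_subset /= h].
have ps : (index p (0%R :: s) < (size s).+1)%N by rewrite index_mem inE pD orbT.
apply: lt_le_trans h _; rewrite lerD2r.
have := @le_maxaff _ _ _ (fun i => vp (nth 0 (0 :: s) i)) (Ordinal ps) x.
by rewrite [nat_of_ord _]/= nth_index // inE pD orbT.
Unshelve. all: by end_near. Qed.

Definition affine_on (U : set 'rV[R]_n) f : bool :=
  `[< exists w, forall y, U y -> f y = affine_fun w y >].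

Lemma generic_copies m (v : 'I_m.+1 -> 'rV[R]_(n + 1)) N (eta : R) : 0 < eta ->
  exists fs : seq (Conv R n), [/\ size fs = N,
    forall f, f \in fs -> forall x, `|f x - maxaff v x| <= eta &
    forall x, exists U, [/\ open U, U x & (N <= n + count (affine_on U) fs)%N]].
Proof.
move=> eta0; have [eps eps_eta eps_gen] := @generic_perturbation R n m N v eta eta0.
pose F j := conv_max (fun i => v i + level n (eps i j)).
exists [seq F j | j <- enum 'I_N]; split; first by rewrite size_map size_enum_ord.
  move=> f /mapP[j _ ->] x /=; rewrite ler_norml lerBrDr lerBlDr.
  apply/andP; split.
    rewrite addrC lerBlDr; apply: maxaff_le => i.
    have := @le_maxaff _ _ _ (fun i => v i + level n (eps i j)) i x.
    rewrite affine_funD affine_fun_level => h.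
    by have /andP[] := eps_eta i j; lra.
  apply: maxaff_le => i; rewrite affine_funD affine_fun_level.
  by have := le_maxaff v i x; have /andP[] := eps_eta i j; lra.
move=> x; pose good j := `[< exists w, \forall y \near x, F j y = affine_fun w y >].
(* For a copy that is not affine near [x] the value 0 is a dummy. *)
have /choice[w hw] : forall j, exists w, good j ->
    \forall y \near x, F j y = affine_fun w y.
  move=> j; case: (boolP (good j)) => [/asboolP[w h]|]; first by exists w.
  by exists 0.
pose A := [set y | forall j, good j -> F j y = affine_fun (w j) y].
exists (interior A); split; first exact: open_interior.
  apply: (@filter_forall _ _ (fun j y => good j -> F j y = affine_fun (w j) y)
    (nbhs x)) => j.
  case: (boolP (good j)) => [/hw h|_]; first by near do move=> _.
  exact: (@nearW _ (nbhs x)).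
(* A bad copy has a tie at [x], so n + 1 bad copies would form a configuration excluded by the
   choice of [eps]. *)
have bad : (#|[pred j | ~~ good j]| <= n)%N.
  rewrite leqNgt; apply/negP => nb.
  pose jj (k : 'I_n.+1) : 'I_N := enum_val (widen_ord nb k).
  apply: (eps_gen x jj) => [k k' /enum_val_inj /(congr1 val) /= e|k].
    exact: val_inj.
  have : ~~ good (jj k) by have := enum_valP (widen_ord nb k); rewrite inE.
  apply: contraNP => nt.
  have [i i' ii'|i hi] := @maxaff_affine_near R n m
      (fun i => v i + level n (eps i (jj k))) x.
    by apply/eqP => e; apply: nt; exists i, i'.
  by apply/asboolP; exists (v i + level n (eps i (jj k))).
rewrite -{1}(card_ord N) -(cardC good) addnC leq_add //.
have -> : #|good| = count good (enum 'I_N) by rewrite cardE enumT -size_filter.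
rewrite count_map.
apply: sub_count => j /= gj; apply/asboolP; exists (w j) => y /interior_subset.
exact.
Unshelve. all: by end_near. Qed.

Lemma generic_approximation f (K : set 'rV[R]_n) N (eta : R) :
  compact K -> 0 < eta ->
  exists fs : seq (Conv R n), [/\ size fs = N,
    forall g, g \in fs -> forall x, K x -> `|g x - f x| < eta &
    forall x, exists U, [/\ open U, U x & (N <= n + count (affine_on U) fs)%N]].
Proof.
move=> cK eta0; have eta2 : 0 < eta / 2 by rewrite divr_gt0.
have [m [v [vle vge]]] := maxaff_approx f cK eta2.
have [fs [sfs fsv fsU]] := generic_copies v N eta2.
exists fs; split=> // g gfs x Kx.
have := fsv g gfs x; have := vle x; have := vge x Kx.
rewrite ler_norml ltr_norml => h1 h2 /andP[h3 h4]; apply/andP; split; lra.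
Qed.

End Approximation.

(** * The topology of Conv *)

Section ConvTopology.
Variables (R : realType) (n : nat).
Implicit Types (f g : Conv R n) (x y : 'rV[R]_n).

Lemma continuous_dist_near (T : topologicalType) (h : T -> R) p :
  (forall e, 0 < e -> \forall q \near p, `|h p - h q| < e) ->
  {for p, continuous h}.
Proof. by move=> H; apply/cvgrPdist_lt. Qed.

(** Upper semicontinuity bounds [f] from above, and a supporting affine function bounds it from
    below. *)
Lemma Conv_continuous f : continuous (f : 'rV[R]_n -> R).
Proof.
move=> x; have [v vx vf] := conv_subgradient f x.
apply: continuous_dist_near => e e0; near=> y.
rewrite ltr_norml; apply/andP; split.
  have : f y < f x + e by near: y; exact: conv_usc.
  by lra.
have : f x - e / 2 <= affine_fun v y.
  near: y; apply: (@near_le_of_lt _ _ (fun=> f x - e / 2) (affine_fun v)).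
  - exact: cst_continuous.
  - exact: affine_fun_continuous.
  by rewrite vx ltrBlDr ltrDl divr_gt0.
have := vf y; lra.
Unshelve. all: by end_near. Qed.

Lemma Conv_bounded f (K : set 'rV[R]_n) : compact K ->
  exists2 B, 0 < B & forall x, K x -> `|f x| <= B.
Proof.
move=> cK; have : compact (f @` K).
  by apply: continuous_compact => //; apply: continuous_subspaceT; exact: Conv_continuous.
move=> /compact_bounded /pinfty_ex_gt0[B B0 hB].
by exists B => // x Kx; apply: hB; exists x.
Qed.

Lemma cvg_ConvP (F : set_system (Conv R n)) g : Filter F ->
  F --> g <-> forall K eta, compact K -> 0 < eta ->
    F [set h : Conv R n | forall x, K x -> `|g x - h x| < eta].
Proof.
move=> FF; split=> [Fg K eta cK eta0|H].
  have c := @initial_continuous _ _ (@conv_fun R n : Conv R n -> {family compact, 'rV[R]_n -> R}) g.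
  have nK := @fam_nbhs _ _ compact K _ (@conv_fun R n g) (@entourage_ball R R (PosNum eta0)) cK.
  by apply: Fg; exact: (c _ nK).
have c : {family compact, (@conv_fun R n : Conv R n -> 'rV[R]_n -> R) @ F --> @conv_fun R n g}.
  apply/fam_cvgP => K cK P /uniform_nbhs[E [+ sEP]].
  rewrite -entourage_from_ballE => -[e e0 sE].
  rewrite /fmap /=; apply: filterS (H K e cK e0) => h hh.
  by apply: sEP => y Ky; apply: sE; exact: hh.
move=> U [_ [[W oW <-] Wg] sWU].
apply: filterS sWU _; apply: (c W); exact: open_nbhs_nbhs.
Qed.

Lemma nbhs_Conv g (K : set 'rV[R]_n) (eta : R) : compact K -> 0 < eta ->
  nbhs g [set h : Conv R n | forall x, K x -> `|g x - h x| < eta].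
Proof. by move=> cK eta0; move/cvg_ConvP: (@cvg_id _ (nbhs g)); apply. Qed.

Lemma conv_scale_continuous t : continuous (@conv_scale R n t).
Proof.
move=> f; have FF : Filter (conv_scale t @ nbhs f) by exact: fmap_filter.
apply: (proj2 (@cvg_ConvP _ _ FF)) => K eta cK eta0.
have t1 : 0 < t%:num + 1 by rewrite ltr_wpDl.
have e0 : 0 < eta / (t%:num + 1) by rewrite divr_gt0.
change (nbhs f [set h : Conv R n |
  forall x, K x -> `|t%:num * f x - t%:num * h x| < eta]).
near=> h; move=> x Kx.
rewrite -mulrBr normrM ger0_norm //.
have : `|f x - h x| < eta / (t%:num + 1).
  by move: x Kx; near: h; exact: nbhs_Conv.
rewrite ltr_pdivlMr // => hx.
have := normr_ge0 (f x - h x); nra.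
Unshelve. all: by end_near. Qed.

Lemma continuous_Conv_bound (Phi : Conv R n -> R[i]) g (e : R[i]) :
  continuous (Phi : Conv R n -> R[i]^o) -> 0 < e ->
  exists K eta, [/\ compact K, 0 < eta & forall h : Conv R n,
    (forall x, K x -> `|h x - g x| < eta) -> `|Phi h - Phi g| < e].
Proof.
move=> cPhi e0.
(* The basic neighbourhoods of [g] generate this filter; convergence of [Phi] along it yields a
   single pair of [K] and [eta]. *)
pose F := filter_from [set p : set 'rV[R]_n * R | compact p.1 /\ 0 < p.2]
  (fun p => [set h : Conv R n | forall x, p.1 x -> `|h x - g x| < p.2]).
have FF : Filter F.
  apply: filter_from_filter.
    by exists (set0, 1); split => //; exact: compact0.
  move=> [K1 e1] [K2 e2] [/= c1 p1] [/= c2 p2].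
  exists (K1 `|` K2, Num.min e1 e2).
    by split; [exact: compactU|rewrite lt_min p1].
  move=> h /= H; split => x Kx.
    by have := H x (or_introl Kx); rewrite lt_min => /andP[].
  by have := H x (or_intror Kx); rewrite lt_min => /andP[].
have Fg : F --> g.
  apply/cvg_ConvP => K eta cK eta0; exists (K, eta) => // h H x Kx.
  by rewrite distrC; exact: H.
have cF : (Phi : Conv R n -> R[i]^o) @ F --> (Phi g : R[i]^o).
  exact: cvg_trans (cvg_app _ Fg) (cPhi g).
have [[K eta] [/= cK eta0] H] := @cvgr_dist_lt _ R[i]^o _ _ _ _ _ cF e e0.
exists K, eta; split => // h hh; rewrite distrC; exact: H.
Qed.

End ConvTopology.

(** * Locality of Radon measures *)

Section RadonLocal.
Variables (R : realType) (n : nat).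
Implicit Types (mu nu : Radon R n) (phi psi : Cc R n) (x y : 'rV[R]_n).

Lemma radonD mu nu phi : (mu + nu) phi = mu phi + nu phi. Proof. by []. Qed.
Lemma radonZ (a : R[i]) mu phi : (a *: mu) phi = a * mu phi. Proof. by []. Qed.
Lemma radon0 phi : (0 : Radon R n) phi = 0. Proof. by []. Qed.

Lemma radon_sum (I : finType) (p : pred I) (F : I -> Radon R n) phi :
  (\sum_(i | p i) F i) phi = \sum_(i | p i) F i phi.
Proof.
by apply: (big_morph (fun mu : Radon R n => mu phi)) => [mu nu|]; [exact: radonD|exact: radon0].
Qed.

Lemma radon_inj mu nu : (forall phi, mu phi = nu phi) -> mu = nu.
Proof. by move=> e; apply: val_inj; exact/funext. Qed.

Lemma radon_linear mu (a : R[i]) phi psi :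
  mu (a *: phi + psi) = a * mu phi + mu psi.
Proof. by have /asboolP[+ _] := radon_funP mu; apply. Qed.

Lemma Cc_inj phi psi : phi =1 psi -> phi = psi.
Proof. by move=> e; apply: val_inj; exact/funext. Qed.

Lemma tsupport_mulr (b : 'rV[R]_n -> R) (phi : 'rV[R]_n -> R[i]) :
  tsupport (fun x => (b x)%:C * phi x) `<=` tsupport phi.
Proof.
apply: closure_subset => x /=; apply: contraNN => /eqP ->; by rewrite mulr0.
Qed.

Lemma normC_real (r : R) : `|r%:C| = `|r|%:C.
Proof. by rewrite normc_def /= expr0n addr0 sqrtr_sqr. Qed.

Lemma continuous_real_complex (T : topologicalType) (b : T -> R) :
  continuous b -> continuous (fun t => (b t)%:C : R[i]^o).
Proof.
move=> cb t; apply/cvgrPdist_lt => e e0.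
have e_real : e = (complex.Re e)%:C by rewrite RRe_real // gtr0_real.
have Re0 : 0 < complex.Re e by rewrite -ltcR -e_real.
near=> y; rewrite -rmorphB /= normC_real e_real ltcR.
near: y; exact: (@cvgr_dist_lt _ R^o _ _ _ _ _ (cb t) _ Re0).
Unshelve. all: by end_near. Qed.

Lemma Cc_mul_subproof (b : 'rV[R]_n -> R) phi : continuous b ->
  (fun x => (b x)%:C * phi x) \in @Cc_pred R n.
Proof.
have /asboolP[cphi kphi] := Cc_funP phi.
move=> /continuous_real_complex cb; apply/asboolP; split.
  by move=> x; exact: (@cvgM R[i] _ _ _ _ _ _ _ (cb x) (cphi x)).
apply: subclosed_compact kphi _; first exact: closed_closure.
exact: tsupport_mulr.
Qed.

Definition Cc_mul (b : 'rV[R]_n -> R) (cb : continuous b) phi : Cc R n :=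
  MkCc (Cc_mul_subproof phi cb).

(** For positive [r], a cutoff equal to 1 on the ball of radius [r / 2] and to 0 outside that of
    radius [r]. *)
Definition tent x (r : R) y : R := Num.min 1 (Num.max 0 (2 - 2 / r * `|x - y|)).

Lemma tent_continuous x r : continuous (tent x r).
Proof.
move=> y; apply: (@continuous_min R _ (cst 1)
  ((cst 0 : 'rV_n -> R) \max (fun y => 2 - 2 / r * `|x - y|))).
  exact: cst_continuous.
apply: continuous_max; first exact: cst_continuous.
have c1 : continuous (fun z : 'rV[R]_n => `|x - z|).
  by move=> z; exact: (cvg_norm (cvgB (cvg_cst _) (@cvg_id _ _))).
exact: (cvgB (cvg_cst _) (cvgM (cvg_cst _) (c1 y))).
Qed.

Lemma tent_compl_continuous x r : continuous (fun y => 1 - tent x r y).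
Proof. by move=> y; exact: (cvgB (cvg_cst _) (@tent_continuous x r y)). Qed.

Lemma tent_eq1 x r y : 0 < r -> `|x - y| < r / 2 -> tent x r y = 1.
Proof.
move=> r0 xy; have h : 2 / r * `|x - y| <= 1.
  rewrite mulrAC ler_pdivrMr // mul1r mulrC -ler_pdivlMr //; exact: ltW.
by rewrite /tent min_l // le_max; apply/orP; right; lra.
Qed.

Lemma tent_neq0 x r y : 0 < r -> tent x r y != 0 -> `|x - y| < r.
Proof.
move=> r0; apply: contra_neqT; rewrite -leNgt => xy.
rewrite /tent max_l ?min_r // subr_le0 mulrAC ler_pdivlMr //.
by rewrite ler_pM2l.
Qed.

(* Multiplying a test function by 1 - tent does not change its integral, and
   finitely many such factors annihilate it. *)
Lemma radon_local_eq0 mu :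
  (forall x, exists U : set 'rV[R]_n, [/\ open U, U x &
     forall phi, tsupport phi `<=` U -> mu phi = 0]) -> mu = 0.
Proof.
move=> loc.
have /choice[r hr] : forall x, exists r : R, 0 < r /\
    forall phi, tsupport phi `<=` closure (ball x r) -> mu phi = 0.
  move=> x; have [U [oU Ux hU]] := loc x.
  have /nbhs_closedballP[r rU] : nbhs x U by exact: open_nbhs_nbhs.
  exists r%:num; split => // phi sphi; apply: hU; exact: subset_trans rU.
apply: radon_inj => phi; rewrite radon0.
have mu_cut x psi : mu (Cc_mul (@tent_compl_continuous x (r x)) psi) = mu psi.
  have [r0 hx] := hr x.
  have e : psi = (1 : R[i]) *: Cc_mul (@tent_continuous x (r x)) psi +
      Cc_mul (@tent_compl_continuous x (r x)) psi.
    apply: Cc_inj => y.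
    change (psi y = 1 * ((tent x (r x) y)%:C * psi y) +
      (1 - tent x (r x) y)%:C * psi y).
    by rewrite rmorphB rmorph1; ring.
  rewrite [in RHS]e radon_linear mul1r (hx (Cc_mul (@tent_continuous _ _) psi)) ?add0r //.
  apply: closure_subset => y /=; rewrite mulf_eq0 negb_or => /andP[by0 _].
  rewrite -ball_normE /=; apply: tent_neq0 => //.
  by apply: contraNneq by0 => ->.
pose cut (s : seq 'rV[R]_n) :=
  foldr (fun x psi => Cc_mul (@tent_compl_continuous x (r x)) psi) phi s.
have mu_cuts s : mu (cut s) = mu phi.
  by elim: s => [//|x s IH] /=; rewrite mu_cut.
have cut_eq0 s y : phi y = 0 \/ (exists2 x, x \in s & tent x (r x) y = 1) ->
    cut s y = 0.
  elim: s => [[//|[x //]]|x s IH] /= h.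
  have [-> |b1] := eqVneq (tent x (r x) y) 1; first by rewrite subrr mul0r.
  rewrite IH ?mulr0 //; case: h => [|[z]]; first by left.
  rewrite inE => /orP[/eqP -> e|zs e]; first by rewrite e eqxx in b1.
  by right; exists z.
have /asboolP[_] := Cc_funP phi; rewrite compact_cover.
(* On the half-radius balls [1 - tent] vanishes, so a finite subcover annihilates [phi]. *)
move=> /(_ _ setT (fun x => ball x (r x / 2)))[].
- by move=> x _; exact: ball_open.
- move=> x _; exists x => //; apply: ballxx; rewrite divr_gt0 //.
  by have [] := hr x.
move=> D _ KD; rewrite -(mu_cuts (finmap.enum_fset D)).
have -> : cut (finmap.enum_fset D) = (0 : R[i]) *: phi + 0.
  apply: Cc_inj => y; rewrite cut_eq0.
    by change (0 = 0 * phi y + 0); rewrite mul0r addr0.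
  have [->|py] := eqVneq (phi y) 0; [by left|right].
  have [|x xD] := KD y; first exact: subset_closure.
  rewrite -ball_normE /= => xy; exists x => //.
  by apply: tent_eq1 => //; have [] := hr x.
rewrite radon_linear mul0r add0r.
have := radon_linear mu 1 0 0; rewrite scaler0 addr0 mul1r.
by move=> /eqP; rewrite -subr_eq0 opprD addNKr oppr_eq0 => /eqP.
Qed.

End RadonLocal.

(** * Homogeneous decomposition *)

Section VanishingDifferences.
Variables (R : realType) (n : nat).
Implicit Types (f g h : Conv R n) (x y : 'rV[R]_n) (phi : Cc R n).

(* Differences in the directions that are affine on U lower the degree in affine
   translations, and the other differences do not raise it. *)
Lemma fdiff_local_eq0 (W : zmodType) (U : set 'rV[R]_n) (Phi : Conv R n -> W) c fs g :
  (forall g h, (forall x, U x -> g x = h x) -> Phi g = Phi h) ->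
  (forall g, degree_lt c (fun v => Phi (g + aff v))) ->
  (c <= count (affine_on U) fs)%N -> fdiff Phi fs g = 0.
Proof.
elim: fs Phi c g => [|f fs IH] Phi c g PhiU Phi_deg.
  by rewrite leqn0 => /eqP c0; have := Phi_deg g [::] 0; rewrite c0 /= aff0 addr0 => ->.
rewrite -fdiff_delta /= => cs.
have deltaU g1 g2 : (forall x, U x -> g1 x = g2 x) -> delta f Phi g1 = delta f Phi g2.
  move=> e; rewrite /delta (PhiU g1 g2 e) (PhiU (g1 + f) (g2 + f)) // => x Ux.
  by rewrite !conv_addE e.
case: (boolP (affine_on U f)) cs => [/asboolP[w fw]|_] cs; last first.
  apply: (IH _ c) => // g'.
  apply: (@degree_ltB _ _ _ (fun v => Phi (g' + aff v + f)) (fun v => Phi (g' + aff v))) => //.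
  apply: eq_degree_lt (Phi_deg (g' + f)) _ => v.
  by rewrite [g' + f + _]addrAC.
case: c Phi_deg cs => [|c] Phi_deg cs.
  have Phi0 g' : Phi g' = 0 by have := Phi_deg g' [::] 0 erefl; rewrite /= aff0 addr0.
  apply: (IH _ 0%N) => // g'; apply: degree_lt0 => v.
  by rewrite /delta !Phi0 subrr.
apply: (IH _ c) => // g'.
move/degree_ltS: (Phi_deg g') => /(_ w) hw; apply: eq_degree_lt hw _ => v.
rewrite /delta affD addrA; congr (_ - _); apply: PhiU => x Ux.
by rewrite !conv_addE !affE fw.
Qed.

(** Coordinates are additive, so by the product rule a monomial has Fréchet degree at most its total
    degree. *)
Lemma polynomial_degree_lt m d (P : 'rV[R]_m -> Radon R n) phi :
  polynomial_map d P -> degree_lt d.+1 (fun v => P v phi).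
Proof.
move=> [c Pc]; apply: (@eq_degree_lt 'rV[R]_m R[i] d.+1 (fun v =>
  \sum_(alpha : {ffun 'I_m -> 'I_d.+1} | (\sum_i alpha i <= d)%N)
    c alpha phi * \prod_i (v 0 i)%:C ^+ alpha i)); last first.
  move=> v; rewrite Pc radon_sum; apply: eq_bigr => alpha _.
  rewrite radonZ mulrC; congr (_ * _); rewrite rmorph_prod.
  by apply: eq_bigr => i _; rewrite rmorphXn.
apply: degree_lt_sum => alpha ad.
apply: (@degree_ltW _ _ (0 + \sum_i alpha i).+1); first by rewrite ltnS.
apply: (@degree_ltM _ _ _ _ (fun=> c alpha phi)); first exact: degree_lt_cst.
apply: degree_lt_prod => i; apply: degree_ltX; apply: degree_lt_additive => v w.
by rewrite mxE rmorphD.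
Qed.

(** Allows the equal directions [f] to be replaced by distinct approximations. The base point varies
    too, since the induction shifts it by a direction. *)
Lemma fdiff_continuous (Phi : Conv R n -> R[i]) N f g (e : R[i]) :
  continuous (Phi : Conv R n -> R[i]^o) -> 0 < e ->
  exists K eta, [/\ compact K, 0 < eta & forall fs (g' : Conv R n), size fs = N ->
    (forall h : Conv R n, h \in fs -> forall x, K x -> `|h x - f x| < eta) ->
    (forall x, K x -> `|g' x - g x| < eta) ->
    `|fdiff Phi fs g' - fdiff Phi (nseq N f) g| < e].
Proof.
move=> cPhi; elim: N g e => [|N IH] g e e0.
  have [K [eta [cK eta0 H]]] := continuous_Conv_bound g cPhi e0.
  by exists K, eta; split=> // fs g' /size0nil -> _ hg'; exact: H.
have e2 : 0 < e / 2 by rewrite divr_gt0.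
have [K1 [eta1 [cK1 eta10 H1]]] := IH (g + f) _ e2.
have [K2 [eta2 [cK2 eta20 H2]]] := IH g _ e2.
(* The shifted base point carries the errors of both [g'] and [h], hence the half. *)
pose eta := Num.min (eta1 / 2) eta2.
have le1 : eta <= eta1 / 2 by rewrite ge_min lexx.
have le2 : eta <= eta2 by rewrite ge_min lexx orbT.
exists (K1 `|` K2), eta; split=> [||[//|h fs] g' [sfs] hfs hg'].
- exact: compactU.
- by rewrite lt_min divr_gt0.
rewrite /= subr_interchange; apply: (le_lt_trans (ler_normB _ _)).
rewrite [ltRHS]splitr; apply: ltrD.
  apply: H1 => // [k kfs x K1x|x K1x].
    by have := hfs k; rewrite inE kfs orbT => /(_ isT x (or_introl K1x)); lra.
  rewrite !conv_addE.
  have -> : g' x + h x - (g x + f x) = (g' x - g x) + (h x - f x) by ring.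
  apply: (le_lt_trans (ler_normD _ _)).
  have := hg' x (or_introl K1x); have := hfs h (mem_head _ _) x (or_introl K1x).
  by lra.
apply: H2 => // [k kfs x K2x|x K2x].
  by have := hfs k; rewrite inE kfs orbT => /(_ isT x (or_intror K2x)); lra.
by have := hg' x (or_intror K2x); lra.
Qed.

Lemma numField_eq0 (F : numFieldType) (z : F) : (forall e, 0 < e -> `|z| < e) -> z = 0.
Proof.
move=> H; apply/eqP/negP => /negP z0; have := H `|z|.
by rewrite normr_gt0 z0 ltxx => /(_ isT).
Qed.

Lemma fdiff_functional_eq0 d (Psi : Conv R n -> Radon R n) f g :
  Psi \in @PLV R n d -> fdiff Psi (nseq (n + d).+1 f) g = 0.
Proof.
move=> /asboolP[/continuous_RadonP cPsi lPsi pPsi].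
apply: radon_inj => phi; rewrite radon0.
rewrite (@fdiff_raddf _ _ _ (fun mu : Radon R n => mu phi)) //.
apply: numField_eq0 => e e0.
have [K [eta [cK eta0 H]]] := fdiff_continuous (n + d).+1 f g (cPsi phi) e0.
have [fs [sfs fsf fsU]] := generic_approximation f (n + d).+1 cK eta0.
have := H fs g sfs fsf; rewrite distrC.
have -> : fdiff (fun g => Psi g phi) fs g = 0.
  rewrite -(@fdiff_raddf _ _ _ (fun mu : Radon R n => mu phi)) //.
  rewrite (_ : fdiff Psi fs g = 0) //.
  apply: radon_local_eq0 => x; have [U [oU Ux hU]] := fsU x.
  exists U; split=> // psi spsi.
  rewrite (@fdiff_raddf _ _ _ (fun mu : Radon R n => mu psi)) //.
  (* At least d + 1 of the n + d + 1 directions are affine on [U], one more than the degree in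
     affine translations. *)
  apply: (@fdiff_local_eq0 _ U _ d.+1).
  - by move=> g1 g2 e12; exact: (lPsi U).
  - move=> g'; apply: eq_degree_lt (polynomial_degree_lt psi (pPsi g')) _ => v.
    by rewrite conv_affineE.
  - by rewrite -(leq_add2l n) addnS.
rewrite subr0; apply => x _; by rewrite subrr normr0.
Qed.

End VanishingDifferences.

(** * Polynomiality along rays and the homogeneous components *)

Section Decomposition.
Variables (R : realType) (n : nat).
Implicit Types (f g h : Conv R n) (x y : 'rV[R]_n) (phi : Cc R n).

Lemma eq_poly_nat (F : numFieldType) (p q : {poly F}) :
  (forall k : nat, p.[k%:R] = q.[k%:R]) -> p = q.
Proof.
move=> e; apply/eqP; rewrite -subr_eq0; apply/negP => /negP pq0.
have ra : all (root (p - q)) [seq k%:R | k <- iota 0 (size (p - q))].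
  by apply/allP => _ /mapP[k _ ->]; rewrite rootE hornerD hornerN e subrr.
have := max_poly_roots pq0 ra.
rewrite map_inj_uniq ?iota_uniq ?size_map ?size_iota ?ltnn => [/(_ isT) //|].
by move=> i j /eqP; rewrite eqr_nat => /eqP.
Qed.

(** Subtracting the interpolant of the first N values leaves a sequence with vanishing N-th
    difference and N initial zeros. *)
Lemma poly_of_fdiff (F : numFieldType) (u : nat -> F) N (s : F) : s != 0 ->
  (forall k, fdiff u (nseq N 1%N) k = 0) ->
  exists2 p : {poly F}, (size p <= N)%N & forall k, u k = p.[s * k%:R].
Proof.
move=> s0 du; pose x : 'rV[F]_N := \row_j (s * j%:R).
have xI : injective (x 0).
  move=> i j; rewrite !mxE => /(mulfI s0) /eqP; rewrite eqr_nat => /eqP.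
  exact: val_inj.
have [p sp hp] := interpolation (\row_j u j) xI.
exists p => // k; apply/eqP; rewrite -subr_eq0; apply/eqP.
move: k; apply: (@fdiff_nseq1_eq0 _ _ N) => [k|j jN].
  by rewrite fdiffB du (degree_lt_horner s sp) ?size_nseq // subrr.
by have := hp (Ordinal jN); rewrite !mxE /= => ->; rewrite subrr.
Qed.

(* Total in t, unlike conv_scale, so that t ranges over a topological space. *)
Definition abs_scale (t : R) f : Conv R n := conv_scale `|t|%:nng f.

Lemma abs_scaleE t f x : abs_scale t f x = `|t| * f x. Proof. by []. Qed.

Lemma conv_scale_abs (t : {nonneg R}) f : conv_scale t f = abs_scale t%:num f.
Proof. by apply: conv_inj => x; rewrite abs_scaleE ger0_norm. Qed.

Lemma abs_scale_continuous f : continuous (fun t => abs_scale t f).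
Proof.
move=> t; have FF : Filter ((fun t => abs_scale t f) @ nbhs t) by exact: fmap_filter.
apply: (proj2 (@cvg_ConvP _ _ _ _ FF)) => K eta cK eta0.
have [B B0 hB] := Conv_bounded f cK.
change (nbhs t [set s | forall x, K x -> `|abs_scale t f x - abs_scale s f x| < eta]).
near=> s; move=> x Kx; rewrite !abs_scaleE -mulrBl normrM.
have ts : `|t - s| < eta / B.
  by near: s; apply: (@cvgr_dist_lt _ R^o _ _ _ _ _ cvg_id); rewrite divr_gt0.
have := ler_dist_dist t s; move: ts; rewrite ltr_pdivlMr //.
have := hB x Kx; have := normr_ge0 (f x); have := normr_ge0 (`|t| - `|s|).
nra.
Unshelve. all: by end_near. Qed.

Lemma horner_abs_continuous (p : {poly R[i]}) :
  continuous (fun t : R => p.[`|t|%:C] : R[i]^o).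
Proof.
have cabs : continuous (fun t : R => `|t|%:C : R[i]^o).
  by apply: continuous_real_complex => t; exact: (cvg_norm (@cvg_id _ _)).
elim/poly_ind: p => [|p c IH] t.
  by rewrite (_ : (fun _ => _) = cst 0); [exact: cvg_cst|apply/funext => s; rewrite horner0].
rewrite (_ : (fun _ => _) = (fun t => p.[`|t|%:C] * `|t|%:C + c)); last first.
  by apply/funext => s; rewrite !hornerE.
exact: (@cvgD R[i] R[i]^o _ _ _ _ _ _ _
  (@cvgM R[i] _ _ _ _ _ _ _ (IH t) (cabs t)) (cvg_cst _)).
Qed.

Lemma dense_rational (t e : R) : 0 <= t -> 0 < e ->
  exists q k : nat, `|t - k%:R / q.+1%:R| < e.
Proof.
move=> t0 e0; have [q _ hq] := near_infty_natSinv_lt (PosNum e0).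
have q0 : 0 < (q.+1%:R : R) by rewrite ltr0n.
exists q, (Num.truncn (t * q.+1%:R)).
have /andP[h1 h2] : (Num.truncn (t * q.+1%:R))%:R <= t * q.+1%:R <
    (Num.truncn (t * q.+1%:R)).+1%:R by apply: truncn_itv; rewrite mulr_ge0 // ltW.
have h3 := hq q (leqnn q); apply: le_lt_trans h3.
rewrite -[ltRHS]natr1 in h2.
set k := (Num.truncn _)%:R in h1 h2 *.
have -> : t - k / q.+1%:R = (t * q.+1%:R - k) / q.+1%:R by field; rewrite lt0r_neq0.
rewrite ger0_norm ?divr_ge0 ?subr_ge0 ?(ltW q0) // ler_pdivrMr // mulVf ?lt0r_neq0 //.
lra.
Qed.

(* The interpolants along the progressions of steps 1 and 1 / (q + 1) agree at all
   natural numbers, hence coincide; continuity extends the identity from the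
   rational numbers to t. *)
Lemma scale_polynomial d (Psi : Conv R n -> Radon R n) f phi :
  Psi \in @PLV R n d ->
  exists2 p : {poly R[i]}, (size p <= (n + d).+1)%N &
    forall t, Psi (conv_scale t f) phi = p.[t%:num%:C].
Proof.
move=> PsiP; pose u (s : R) (k : nat) := Psi (abs_scale (s * k%:R) f) phi.
have du s : 0 <= s -> forall k, fdiff (u s) (nseq (n + d).+1 1%N) k = 0.
  (* For nonnegative [s] the map [E] is additive, so differences of [u s] with step 1 are
     differences of [Psi] in the direction [E 1]. *)
  move=> s0 k; pose E (k : nat) := abs_scale (s * k%:R) f.
  have ED : {morph E : i j / i + j}.
    move=> i j; apply: conv_inj => x; rewrite conv_addE !abs_scaleE natrD.
    by rewrite !ger0_norm ?mulr_ge0 ?addr_ge0 //; ring.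
  rewrite (_ : u s = (fun g => Psi g phi) \o E) //.
  rewrite -(@fdiff_comp _ _ _ _ E) // map_nseq.
  rewrite -(@fdiff_raddf _ _ _ (fun mu : Radon R n => mu phi)) //.
  by rewrite (@fdiff_functional_eq0 _ _ d).
have [p sp up] := poly_of_fdiff (oner_neq0 _) (du 1 ler01).
exists p => // t; rewrite conv_scale_abs.
have t0 : 0 <= t%:num by [].
move: (t%:num) t0 => {}t t0.
have urat (q k : nat) : u (q.+1%:R^-1) k = p.[(k%:R / q.+1%:R)%:C].
  have q0 : (q.+1%:R : R[i])^-1 != 0 by rewrite invr_eq0 pnatr_eq0.
  have [|pq _ upq] := @poly_of_fdiff _ (u q.+1%:R^-1) (n + d).+1 _ q0.
    by apply: du; rewrite invr_ge0.
  have -> : p = pq.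
    apply: eq_poly_nat => j; rewrite -[j%:R]mul1r -up.
    (* Every (q + 1)-st term of the fine progression is a natural number. *)
    have := upq (j * q.+1)%N; rewrite natrM mulrCA mulVf ?pnatr_eq0 // mulr1.
    rewrite mul1r => <-; rewrite /u natrM mulrCA mulVf ?pnatr_eq0 // mulr1.
    by rewrite mul1r.
  by rewrite upq rmorphM fmorphV !rmorph_nat mulrC.
have cPsi : continuous (fun s => Psi (abs_scale s f) phi : R[i]^o).
  move=> s; have /asboolP[/continuous_RadonP cPsi _ _] := PsiP.
  exact: (@continuous_comp _ _ _ (fun s => abs_scale s f)
    (fun g => Psi g phi : R[i]^o) s (@abs_scale_continuous f s) (cPsi phi _)).
pose G (s : R) : R[i]^o := Psi (abs_scale s f) phi - p.[`|s|%:C].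
have cG : continuous G.
  by move=> s; exact: (cvgB (cPsi s) (@horner_abs_continuous p s)).
suff : G t = 0 by rewrite /G ger0_norm // => /eqP; rewrite subr_eq0 => /eqP.
apply: numField_eq0 => e e0.
have [r /= r0 hr] : nbhs_ball t [set s | `|G t - G s| < e].
  by apply/nbhs_ballP; exact: (@cvgr_dist_lt _ R[i]^o _ _ _ _ _ (cG t) _ e0).
have [q [k tk]] := dense_rational t0 r0.
have : `|G t - G (k%:R / q.+1%:R)| < e by exact: hr.
have -> : G (k%:R / q.+1%:R) = 0.
  by rewrite /G ger0_norm ?divr_ge0 // -urat /u mulrC subrr.
by rewrite subr0.
Qed.

Lemma PLV_scale d (Psi : Conv R n -> Radon R n) (t : {nonneg R}) :
  Psi \in @PLV R n d -> (fun f => Psi (conv_scale t f)) \in @PLV R n d.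
Proof.
move=> /asboolP[cPsi lPsi pPsi]; apply/asboolP; split.
- move=> f; apply: continuous_comp; first exact: conv_scale_continuous.
  exact: cPsi.
- by move=> U f g oU fg; apply: lPsi => // x Ux /=; rewrite fg.
move=> f; have [c hc] := pPsi (conv_scale t f).
(* Scaling by [t] also scales the affine parameter [v], so each monomial gains [t] to its total
   degree. *)
exists (fun alpha : {ffun 'I_(n + 1) -> 'I_d.+1} => (\prod_i t%:num ^+ alpha i)%:C *: c alpha) => v.
have -> : conv_scale t (conv_affine f v) =
    conv_affine (conv_scale t f) (t%:num *: v).
  apply: conv_inj => x; rewrite /= mulrDr; congr (_ + _).
  rewrite /affine_fun mulrDr mulr_sumr; congr (_ + _); last by rewrite !mxE.
  by apply: eq_bigr => i _; rewrite !mxE mulrA.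
rewrite hc; apply: eq_bigr => alpha _; rewrite scalerA -rmorphM -big_split /=.
by congr (_%:C *: _); apply: eq_bigr => i _; rewrite mxE exprMn mulrC.
Qed.

(** Against a test function the sum is a polynomial in [t] that vanishes at all natural numbers. *)
Lemma power_sum_unique N (a : 'I_N -> Radon R n) :
  (forall t : {nonneg R}, \sum_(k < N) (t%:num ^+ k)%:C *: a k = 0) -> forall k, a k = 0.
Proof.
move=> a0 k; apply: radon_inj => phi; rewrite radon0.
pose p := rVpoly (\row_(k < N) a k phi).
have p0 : p = 0.
  apply: eq_poly_nat => j; rewrite horner0 (horner_coef_wide _ (size_poly _ _)).
  rewrite -[RHS](radon0 phi) -(a0 j%:R%:nng) radon_sum; apply: eq_bigr => i _.
  by rewrite coef_rVpoly_ord mxE radonZ mulrC rmorphXn rmorph_nat.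
have := coef_rVpoly_ord (\row_(k < N) a k phi) k.
by rewrite -/p p0 coef0 mxE => <-.
Qed.

End Decomposition.

Theorem theorem2 (R : realType) (n d : nat) :
  is_direct_sum (@PLV R n d) (fun k : 'I_(n + d).+1 => @PLVk R n d k).
Proof.
split=> [Psi|w wP w0]; last first.
  have wf f k : w k f = 0.
    move: k; apply: (@power_sum_unique R n) => t.
    have := congr1 (fun v => v (conv_scale t f)) w0.
    rewrite fct_sumE => e; rewrite -[RHS]e; apply: eq_bigr => k _.
    by have /andP[_ /asboolP ->] := wP k.
  by move=> k; apply/funext => f; rewrite wf.
split=> [PsiP|[w wP ->]]; last first.
  by apply: rpred_sum => k _; have /andP[] := wP k.
pose x : 'rV[R[i]]_(n + d).+1 := \row_j j%:R.
pose V := Vandermonde (n + d).+1 x.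
have uV : V \in unitmx.
  apply: Vandermonde_unitmx => i j; rewrite !mxE => /eqP; rewrite eqr_nat => /eqP.
  exact: val_inj.
(* As a combination of dilates of [Psi], each component visibly stays in [PLV]. *)
pose w (k : 'I_(n + d).+1) : Conv R n -> Radon R n := fun f =>
  \sum_j invmx V j k *: Psi (conv_scale (NngNum (ler0n R j)) f).
have wE f t : Psi (conv_scale t f) = \sum_(k < (n + d).+1) (t%:num ^+ k)%:C *: w k f.
  apply: radon_inj => phi; rewrite radon_sum.
  have [p sp hp] := scale_polynomial f phi PsiP.
  rewrite hp (horner_coef_wide _ sp); apply: eq_bigr => k _.
  rewrite radonZ mulrC rmorphXn; congr (_ * _).
  pose a : 'rV[R[i]]_(n + d).+1 := poly_rV p.
  have -> : p`_k = (a *m V *m invmx V) 0 k by rewrite mulmxK // mxE.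
  rewrite radon_sum mxE; apply: eq_bigr => j _.
  rewrite radonZ mulrC hp (horner_coef_wide _ sp) mxE; congr (_ * _).
  by apply: eq_bigr => i _; rewrite !mxE rmorph_nat.
exists w => [k|]; last first.
  apply/funext => f; rewrite fct_sumE.
  have {1}-> : f = conv_scale 1%:nng f by apply: conv_inj => y /=; rewrite mul1r.
  by rewrite wE; apply: eq_bigr => k _; rewrite expr1n scale1r.
apply/andP; split.
  rewrite (_ : w k = \sum_j invmx V j k *: (fun f => Psi (conv_scale (NngNum (ler0n R j)) f))).
    by apply: rpred_sum => j _; apply: rpredZ; exact: PLV_scale.
  by apply/funext => f; rewrite fct_sumE.
(* Homogeneity follows by comparing the two expansions in [t] of [Psi] at [t * s * f]. *)
apply/asboolP => s f; apply/eqP; rewrite -subr_eq0; apply/eqP; move: k.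
apply: power_sum_unique => t.
under eq_bigr do rewrite scalerBr scalerA.
rewrite sumrB -wE (_ : conv_scale t (conv_scale s f) = conv_scale (t%:num * s%:num)%:nng f).
  rewrite wE -sumrB big1 // => k _.
  by rewrite -rmorphM -exprMn subrr.
by apply: conv_inj => y /=; rewrite mulrA.
Qed.
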